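(* Let $\mathbf{A}$ be a countable, weakly oligomorphic, homomorphism-homogeneous relational structure. Then $\mathbf{A}$ has a core $\mathbf{F}$ that is isomorphic to the Fraïssé limit of $\mathcal{C}_{\mathbf{A}}$ (i.e. $\mathbf{F}$ is a countable homogeneous structure with $\mathrm{Age}(\mathbf{F})=\mathcal{C}_{\mathbf{A}}$). Moreover, $\mathbf{F}$ is oligomorphic.
   Context: Relational structures have signatures with only relation symbols (any cardinality); substructures are induced; ''countable'' means finite or countably infinite. A positive existential type in $x_1,\dots,x_n$ is a set of positive existential formulas with free variables among $x_1,\dots,x_n$, defining the intersection of the relations defined by its members; $\mathbf{A}$ is weakly oligomorphic if for each $n$ only finitely many $n$-ary relations are definable by such types. $\mathbf{A}$ is homomorphism-homogeneous if every homomorphism from a finite substructure into $\mathbf{A}$ extends to an endomorphism; homogeneous if every isomorphism between finite substructures extends to an automorphism; oligomorphic if $\mathrm{Aut}(\mathbf{A})$ has finitely many orbits on $A^n$ for each $n$. $\mathrm{Age}(\mathbf{A})$ is the class of finite structures embeddable into $\mathbf{A}$; $\mathcal{C}_{\mathbf{A}}$ is the class of finite structures in $\mathrm{Age}(\mathbf{A})$ such that every homomorphism from them into a member of $\mathrm{Age}(\mathbf{A})$ is an embedding. The Fraïssé limit of a class is the (up to isomorphism unique) countable homogeneous structure having that class as its age. $\mathbf{C}$ is a core if every endomorphism of $\mathbf{C}$ is an embedding; $\mathbf{C}$ is a core of $\mathbf{A}$ if $\mathbf{C}$ is a core, $\mathbf{C}\le\mathbf{A}$, and some endomorphism of $\mathbf{A}$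 has image contained in $C$. *)

(* Defs.v *)
From mathcomp Require Import all_boot all_classical.
Set Implicit Arguments.
Unset Strict Implicit.
Unset Printing Implicit Defensive.
Local Open Scope classical_set_scope.

Record signature := Signature { symbol :> Type; arity : symbol -> nat }.

(* The n-tuples A^n are the functions 'I_n -> A, so that a map f acts on a
   tuple t by f \o t.  Carriers may be empty. *)
Record structure (S : signature) := Structure {
  carrier :> Type;
  interp : forall R : S, set ('I_(arity R) -> carrier) }.

Definition homomorphism (S : signature) (A B : structure S) (f : A -> B) : Prop :=
  forall (R : S) (t : 'I_(arity R) -> A), interp t -> interp (f \o t).

Definition embedding (S : signature) (A B : structure S) (f : A -> B) : Prop :=
  injective f /\
  forall (R : S) (t : 'I_(arity R) -> A), interp t <-> interp (f \o t).

Definition isomorphism (S : signature) (A B : structure S) (f : A -> B) : Prop :=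
  embedding f /\ bijective f.

Definition induced (S : signature) (A : structure S) (X : set A) : structure S :=
  {| carrier := set_type X; interp := fun R t => @interp S A R (val \o t) |}.

(* pe_formula S n: positive existential formulas whose free variables are among
   the n variables indexed by 'I_n; pe_ex binds the variable ord0 of its body. *)
Inductive pe_formula (S : signature) : nat -> Type :=
| pe_rel n (R : S) (v : 'I_(arity R) -> 'I_n) : pe_formula S n
| pe_eq n (i j : 'I_n) : pe_formula S n
| pe_and n (p q : pe_formula S n) : pe_formula S n
| pe_or n (p q : pe_formula S n) : pe_formula S n
| pe_ex n (p : pe_formula S n.+1) : pe_formula S n.

Fixpoint pe_sat (S : signature) (A : structure S) n (p : pe_formula S n) :
    ('I_n -> A) -> Prop :=
  match p in pe_formula _ n return ('I_n -> A) -> Prop with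
  | pe_rel _ R v => fun t => interp (t \o v)
  | pe_eq _ i j => fun t => t i = t j
  | pe_and _ p q => fun t => pe_sat p t /\ pe_sat q t
  | pe_or _ p q => fun t => pe_sat p t \/ pe_sat q t
  | pe_ex _ p => fun t =>
      exists a : A, pe_sat p (fun i => oapp t a (unlift ord0 i))
  end.

Definition pe_type_rel (S : signature) (A : structure S) n
    (T : set (pe_formula S n)) : set ('I_n -> A) :=
  \bigcap_(p in T) [set t | pe_sat p t].

Definition weakly_oligomorphic (S : signature) (A : structure S) : Prop :=
  forall n, finite_set (range (@pe_type_rel S A n)).

Definition homomorphism_homogeneous (S : signature) (A : structure S) : Prop :=
  forall (X : set A), finite_set X ->
  forall f : induced X -> A, homomorphism f ->
  exists g : A -> A, homomorphism g /\ forall x : induced X, g (val x) = f x.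

Definition homogeneous (S : signature) (A : structure S) : Prop :=
  forall (X Y : set A), finite_set X -> finite_set Y ->
  forall f : induced X -> induced Y, isomorphism f ->
  exists g : A -> A,
    isomorphism g /\ forall x : induced X, g (val x) = val (f x).

Definition aut_orbit (S : signature) (A : structure S) n (t : 'I_n -> A) :
    set ('I_n -> A) :=
  [set g \o t | g in [set g : A -> A | isomorphism g]].

Definition oligomorphic (S : signature) (A : structure S) : Prop :=
  forall n, finite_set (range (@aut_orbit S A n)).

(* Classes of structures are predicates structure S -> Prop; set (structure S)
   would be a universe inconsistency. *)
Definition age (S : signature) (A B : structure S) : Prop :=
  finite_set [set: B] /\ exists f : B -> A, embedding f.

Definition core_age (S : signature) (A B : structure S) : Prop :=
  age A B /\
  forall D : structure S, age A D ->
  forall f : B -> D, homomorphism f -> embedding f.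

Definition is_fraisse_limit (S : signature) (K : structure S -> Prop)
    (F : structure S) : Prop :=
  [/\ countable [set: F], homogeneous F & forall B, age F B <-> K B].

Definition is_core (S : signature) (C : structure S) : Prop :=
  forall f : C -> C, homomorphism f -> embedding f.

Definition core_of (S : signature) (A : structure S) (C : set A) : Prop :=
  is_core (induced C) /\
  exists e : A -> A, homomorphism e /\ range e `<=` C.

(* Main.v *)
Require Import Defs.
From mathcomp Require Import all_boot all_classical.
Local Open Scope classical_set_scope.

(* The endomorphism monoid alone carries the argument.  Call a finite set X
   rigid if every endomorphism can be undone on X by another one.  By
   homomorphism-homogeneity the endomorphism orbit of a tuple t is the relation
   defined by the atomic formulas true of t, so weak oligomorphy leaves finitely
   many such orbits; a tuple of minimal orbit is rigid, hence every finite set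
   has a rigid image.  F is built as an increasing union of finite rigid sets,
   adding points so that for every finite X in F and every a there is an
   endomorphism fixing X pointwise and moving a into F.  This extension property
   drives a one-sided construction of an endomorphism into F and a back-and-forth
   construction of automorphisms of F. *)

(** * Dependent choice and finite sets *)

Lemma dependent_choice_nat (T : Type) (P : T -> Prop)
    (R : nat -> T -> T -> Prop) (x0 : T) :
  P x0 -> (forall n x, P x -> exists y, P y /\ R n x y) ->
  exists s : nat -> T,
    s 0 = x0 /\ forall n, P (s n) /\ R n (s n) (s n.+1).
Proof.
move=> Px0 PR.
have /choice[f fP] : forall nx : nat * T,
    exists y, P nx.2 -> P y /\ R nx.1 nx.2 y.
  move=> [n x]; case: (pselect (P x)) => [Px|nPx]; last by exists x.
  by have [y yP] := PR n x Px; exists y.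
pose s := fix s n := if n is m.+1 then f (m, s m) else x0.
have Ps : forall n, P (s n).
  by elim=> [//|n IHn]; have [] := fP (n, s n) IHn.
by exists s; split=> // n; split=> //; have [] := fP (n, s n) (Ps n).
Qed.

Lemma finite_set_tuple (T : Type) (X : set T) :
  finite_set X -> exists n (t : 'I_n -> T), range t = X.
Proof.
move=> /(@finite_seqP {classic T})[s Xs].
exists (size s), (tnth (in_tuple s)); rewrite Xs.
apply/seteqP; split=> x /=.
  by move=> [i _ <-]; apply: mem_tnth.
by move=> /(tnthP (in_tuple s)) [i ->]; exists i.
Qed.

Lemma finite_set_range (n : nat) (T : Type) (t : 'I_n -> T) :
  finite_set (range t).
Proof. exact: finite_image. Qed.

Lemma finite_set_sub_chain (T : Type) (X : nat -> set T) (Y : set T) :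
  (forall n, X n `<=` X n.+1) -> finite_set Y -> Y `<=` \bigcup_n X n ->
  exists n, Y `<=` X n.
Proof.
move=> Xincr /(@finite_seqP {classic T})[s ->].
have Xmono m n : (m <= n)%N -> X m `<=` X n.
  move=> /subnKC <-; elim: (n - m) => [|k IHk]; first by rewrite addn0.
  by rewrite addnS; apply: subset_trans (Xincr _).
elim: s => [_|x s IHs sX]; first by exists 0.
have [|n nP] := IHs.
  by move=> y ys; apply: sX; rewrite /= inE [y \in s]ys orbT.
have [|m _ mP] := sX x; first by rewrite /= inE eqxx.
exists (maxn m n) => y /=; rewrite inE => /orP[/eqP->|ys].
  exact: Xmono (leq_maxl m n) _ mP.
exact: Xmono (leq_maxr m n) _ (nP y ys).
Qed.

Lemma finite_set_minimal (T : Type) (C : set (set T)) (U0 : set T) :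
  finite_set C -> C U0 ->
  exists U, C U /\ forall V, C V -> V `<=` U -> V = U.
Proof.
move=> /(@finite_seqP {classic (set T)})[[|U s] ->] // _.
elim: s U => [|W s IHs] U.
  by exists U; split=> [|V] /=; rewrite inE ?eqxx // => /eqP.
have [M [/= Ms Mmin]] := IHs W.
have [[UM UneM]|nUM] := pselect (U `<=` M /\ U <> M).
  exists U; split=> [|V] /=; first by rewrite inE eqxx.
  rewrite inE => /orP[/eqP//|Vs VU].
  have VM : V = M by apply: Mmin Vs _; apply: subset_trans UM.
  by case: UneM; apply/seteqP; split=> //; rewrite -VM.
exists M; split=> [|V] /=; first by rewrite inE Ms orbT.
rewrite inE => /orP[/eqP->|Vs VM]; last exact: Mmin.
by move=> UM; apply: contrapT => UneM; apply: nUM.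
Qed.

(** * Homomorphisms, embeddings and homogeneity for families of points *)

Lemma homomorphism_id {S : signature} {A : structure S} :
  homomorphism (fun x : A => x).
Proof. by []. Qed.

Lemma homomorphism_comp {S : signature} {A B C : structure S}
    (f : A -> B) (g : B -> C) :
  homomorphism f -> homomorphism g -> homomorphism (g \o f).
Proof. by move=> fhom ghom R t /fhom /ghom. Qed.

Lemma embedding_homomorphism {S : signature} {A B : structure S} (f : A -> B) :
  embedding f -> homomorphism f.
Proof. by move=> [_ fint] R t /fint. Qed.

Lemma embedding_comp {S : signature} {A B C : structure S}
    (f : A -> B) (g : B -> C) :
  embedding f -> embedding g -> embedding (g \o f).
Proof.
move=> [finj fint] [ginj gint]; split=> [|R t]; first exact: inj_comp.
by rewrite fint gint.
Qed.

Lemma embedding_val {S : signature} {A : structure S} (X : set A) :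
  embedding (val : induced X -> A).
Proof. by split=> //; apply: val_inj. Qed.

(** [u] may repeat points: the equality condition makes the map sending [u j] to [v j] well defined
    on the finite set [range u]. *)
Lemma homomorphism_homogeneous_tuple {S : signature} {A : structure S}
    (J : Type) (u v : J -> A) :
  homomorphism_homogeneous A -> finite_set [set: J] ->
  (forall i j, u i = u j -> v i = v j) ->
  (forall (R : S) (s : 'I_(arity R) -> J), interp (u \o s) -> interp (v \o s)) ->
  exists g : A -> A, homomorphism g /\ forall j, g (u j) = v j.
Proof.
move=> hhA finJ uv_eq uv_int.
have /choice[c cP] : forall x : set_type (range u), exists j, u j = val x.
  by move=> x; have [j _ jx] := set_mem (valP x); exists j.
have [|g [ghom gP]] := hhA _ (finite_image u finJ) (v \o c).
  move=> R t tint; apply: (uv_int R (c \o t)).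
  by rewrite (_ : u \o _ = val \o t)//; apply/funext => i /=.
exists g; split=> // j.
pose x : set_type (range u) := SigSub (mem_set (imageT u j)).
by rewrite (gP x) /=; apply: uv_eq; rewrite cP.
Qed.

(** * Endomorphism orbits and positive existential types *)

Definition endo_orbit {S : signature} {A : structure S} {n : nat}
    (t : 'I_n -> A) : set ('I_n -> A) :=
  [set g \o t | g in [set g : A -> A | homomorphism g]].

Lemma endo_orbit_refl {S : signature} {A : structure S} {n : nat}
    (t : 'I_n -> A) : endo_orbit t t.
Proof. by exists id => //; apply: homomorphism_id. Qed.

Lemma endo_orbit_comp {S : signature} {A : structure S} {n : nat}
    (t : 'I_n -> A) (g : A -> A) :
  homomorphism g -> endo_orbit (g \o t) `<=` endo_orbit t.
Proof.
move=> ghom _ [h hhom <-]; exists (h \o g) => //.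
exact: homomorphism_comp.
Qed.

Lemma endo_orbit_pe_type {S : signature} {A : structure S} {n : nat}
    (t : 'I_n -> A) :
  homomorphism_homogeneous A -> range (@pe_type_rel S A n) (endo_orbit t).
Proof.
move=> hhA.
(* The equalities make the map sending [t i] to [s i] well defined and the relational atoms make it
   a homomorphism; conversely, endomorphisms preserve both. *)
exists [set p | (exists R v, p = @pe_rel S n R v /\ interp (t \o v)) \/
                (exists i j, p = @pe_eq S n i j /\ t i = t j)] => //.
apply/seteqP; split=> s.
  move=> sT; have [||||g [ghom gP]] := @homomorphism_homogeneous_tuple S A _ t s.
  - exact: hhA.
  - exact: finite_finset.
  - by move=> i j tij; apply: (sT (pe_eq S i j)); right; exists i, j.
  - by move=> R v tv; apply: (sT (pe_rel v)); left; exists R, v.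
  by exists g => //; apply/funext => i; apply: gP.
move=> [g ghom <-] p [[R [v [-> tv]]]|[i [j [-> tij]]]] /=.
  exact: ghom _ _ tv.
by rewrite tij.
Qed.

Lemma finite_endo_orbits {S : signature} {A : structure S} (n : nat) :
  weakly_oligomorphic A -> homomorphism_homogeneous A ->
  finite_set (range (@endo_orbit S A n)).
Proof.
move=> woA hhA; apply: sub_finite_set (woA n) => _ [t _ <-].
exact: endo_orbit_pe_type.
Qed.

(** * Rigid sets *)

(** For finite [X] in a homomorphism-homogeneous [A], this amounts to [induced X] lying in
    [core_age A]. *)
Definition rigid {S : signature} {A : structure S} (X : set A) : Prop :=
  forall g : A -> A, homomorphism g ->
  exists h : A -> A, homomorphism h /\ forall x, X x -> h (g x) = x.

Lemma rigid_sub {S : signature} {A : structure S} (X Y : set A) :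
  X `<=` Y -> rigid Y -> rigid X.
Proof.
move=> XY Yrig g /Yrig[h [hhom hP]].
by exists h; split=> // x /XY; apply: hP.
Qed.

(** If [h] undoes [g \o k] on [X], then [k \o h] undoes [g] on the image of [X]. *)
Lemma rigid_homomorphic_image {S : signature} {A : structure S} (X : set A)
    (k : A -> A) :
  homomorphism k -> rigid X -> rigid (k @` X).
Proof.
move=> khom Xrig g ghom.
have [h [hhom hP]] := Xrig _ (homomorphism_comp _ _ khom ghom).
exists (k \o h); split; first exact: homomorphism_comp.
by move=> _ [x Xx <-] /=; have /= -> := hP x Xx.
Qed.

Lemma exists_rigid_image {S : signature} {A : structure S} (X : set A) :
  weakly_oligomorphic A -> homomorphism_homogeneous A -> finite_set X ->
  exists k : A -> A, homomorphism k /\ rigid (k @` X).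
Proof.
move=> woA hhA /finite_set_tuple[n [t <-]].
pose C := [set endo_orbit (k \o t) | k in [set k : A -> A | homomorphism k]].
have [||_ [[k khom <-] kmin]] := @finite_set_minimal _ C (endo_orbit t).
- apply: sub_finite_set (finite_endo_orbits n woA hhA) => _ [k _ <-].
  by exists (k \o t).
- by exists id => //; apply: homomorphism_id.
exists k; split=> // g ghom.
(* The orbit of [g \o (k \o t)] lies in that of [k \o t]; minimality makes them equal, so some
   endomorphism leads back to [k \o t]. *)
have [] : endo_orbit (g \o (k \o t)) (k \o t).
  rewrite (kmin (endo_orbit (g \o (k \o t)))); first exact: endo_orbit_refl.
  - by exists (g \o k) => //; apply: homomorphism_comp.
  - exact: endo_orbit_comp.
move=> h hhom /funeqP hP; exists h; split=> //.
by move=> _ [_ [i _ <-] <-]; apply: hP.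
Qed.

(** Send [X] and [a] to a rigid set by [k], then bring [X] back by an [h] undoing [k] on it; the
    image under [h] stays rigid. *)
Lemma rigid_extend {S : signature} {A : structure S} (X : set A) (a : A) :
  weakly_oligomorphic A -> homomorphism_homogeneous A ->
  finite_set X -> rigid X ->
  exists g : A -> A,
    [/\ homomorphism g, forall x, X x -> g x = x & rigid (X `|` [set g a])].
Proof.
move=> woA hhA finX Xrig.
have [|k [khom krig]] := @exists_rigid_image S A (X `|` [set a]) woA hhA.
  by rewrite finite_setU.
have [h [hhom hP]] := Xrig k khom.
exists (h \o k); split=> //; first exact: homomorphism_comp.
apply: rigid_sub (rigid_homomorphic_image _ _ hhom krig).
move=> x [Xx|->] /=; last by exists (k a) => //; exists a => //; right.
by exists (k x); [exists x => //; left|apply: hP].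
Qed.

(** * Construction of the set F *)

Definition rich_core {S : signature} {A : structure S} (F : set A) : Prop :=
  (forall X, finite_set X -> X `<=` F -> rigid X) /\
  (forall X, finite_set X -> X `<=` F -> forall a, exists g : A -> A,
    [/\ homomorphism g, forall x, X x -> g x = x & F (g a)]).

Lemma exists_rich_core {S : signature} {A : structure S} :
  countable [set: A] -> weakly_oligomorphic A -> homomorphism_homogeneous A ->
  exists F : set A, rich_core F.
Proof.
move=> /countable_injP[f finj] woA hhA.
(* Each a is treated at the infinitely many stages n = 2 ^ f a * 3 ^ m. *)
pose R n (X Y : set A) := X `<=` Y /\ forall a, f a = logn 2 n ->
  exists g : A -> A,
    [/\ homomorphism g, forall x, X x -> g x = x & Y (g a)].
have [||X [_ XP]] :=
    @dependent_choice_nat _ (fun X : set A => finite_set X /\ rigid X) R set0.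
- split=> // g _; exists id; split=> //; exact: homomorphism_id.
- move=> n X [finX Xrig].
  have [[a fa]|na] := pselect (exists a, f a = logn 2 n); last first.
    by exists X; split=> //; split=> // a fa; case: na; exists a.
  have [g [ghom gfix grig]] := rigid_extend X a woA hhA finX Xrig.
  exists (X `|` [set g a]); split; first by rewrite finite_setU.
  split=> [|b fb]; first exact: subsetUl.
  exists g; split=> //; right; congr g.
  by apply: finj; rewrite ?inE // fa fb.
have Xincr n : X n `<=` X n.+1 by have [_ []] := XP n.
exists (\bigcup_n X n); split=> Y finY YF.
  have [n YX] := finite_set_sub_chain _ _ _ Xincr finY YF.
  by apply: rigid_sub YX _; have [[]] := XP n.
move=> a; have [m YX] := finite_set_sub_chain _ _ _ Xincr finY YF.
(* A stage that treats [a] after [Y] has been absorbed: a map fixing [X n] pointwise also fixes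
   [Y]. *)
pose n := (2 ^ f a * 3 ^ m)%N.
have mn : (m <= n)%N.
  by apply: leq_trans (leq_pmull _ _); rewrite ?expn_gt0 // ltnW // ltn_expl.
have XmXn : X m `<=` X n.
  rewrite -(subnKC mn); elim: (n - m) => [|k IHk]; first by rewrite addn0.
  by rewrite addnS; apply: subset_trans (Xincr _).
have [_ [_ /(_ a)[|g [ghom gfix gF]]]] := XP n.
  by rewrite /n lognM ?expn_gt0 // !lognX muln1 muln0 addn0.
by exists g; split=> // [x /YX/XmXn/gfix //|]; exists n.+1.
Qed.

(** * Limits of finite approximations *)

(** A pair [(g, X)] stands for the finite partial map [g] on [X]. It carries a total endomorphism,
    so that extension steps can compose and undo endomorphisms. *)
Definition finite_approx {S : signature} {A : structure S} (D F : set A)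
    (s : (A -> A) * set A) : Prop :=
  [/\ homomorphism s.1, finite_set s.2, s.2 `<=` D & s.1 @` s.2 `<=` F].

Definition approx_le {T : Type} (s s' : (T -> T) * set T) : Prop :=
  s.2 `<=` s'.2 /\ forall x, s.2 x -> s'.1 x = s.1 x.

Lemma approx_le_refl {T : Type} (s : (T -> T) * set T) : approx_le s s.
Proof. by split. Qed.

Lemma approx_le_trans {T : Type} (s1 s2 s3 : (T -> T) * set T) :
  approx_le s1 s2 -> approx_le s2 s3 -> approx_le s1 s3.
Proof.
move=> [s12 e12] [s23 e23]; split; first exact: subset_trans s23.
by move=> x s1x; rewrite e23 ?e12 //; apply: s12.
Qed.

(** With [E] empty this is a one-sided construction, with [D] and [E] both [F] a back-and-forth. [G]
    need not be an endomorphism, but agrees with one on each finite part of [D]. *)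
Lemma approx_limit {S : signature} {A : structure S} (D E F : set A)
    (s0 : (A -> A) * set A) :
  countable [set: A] -> finite_approx D F s0 ->
  (forall s, finite_approx D F s -> forall a, D a ->
    exists s', [/\ finite_approx D F s', approx_le s s' & s'.2 a]) ->
  (forall s, finite_approx D F s -> forall b, E b ->
    exists s', [/\ finite_approx D F s', approx_le s s' & (s'.1 @` s'.2) b]) ->
  exists G : A -> A,
    [/\ forall x, s0.2 x -> G x = s0.1 x, G @` D `<=` F, E `<=` G @` D
      & forall Y, finite_set Y -> Y `<=` D ->
        exists g : A -> A, homomorphism g /\ forall y, Y y -> G y = g y].
Proof.
move=> /countable_injP[f finj'] s0P forth back.
have finj a b : f a = f b -> a = b by apply: finj'; rewrite inE.
pose R n (s s' : (A -> A) * set A) :=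
  [/\ approx_le s s', forall a, D a -> f a = n -> s'.2 a
    & forall b, E b -> f b = n -> (s'.1 @` s'.2) b].
have [//||s [s00 sP]] := @dependent_choice_nat _ (finite_approx D F) R s0.
  move=> n s1 s1P.
  have [s2 [s2P s12 s2D]] : exists s2, [/\ finite_approx D F s2,
      approx_le s1 s2 & forall a, D a -> f a = n -> s2.2 a].
    have [[a [Da fa]]|na] := pselect (exists a, D a /\ f a = n); last first.
      exists s1; split=> // [|a Da fa]; first exact: approx_le_refl.
      by case: na; exists a.
    have [s2 [s2P s12 s2a]] := forth _ s1P a Da.
    by exists s2; split=> // b _; rewrite -fa => /finj->.
  have [[b [Eb fb]]|nb] := pselect (exists b, E b /\ f b = n); last first.
    by exists s2; split=> //; split=> // b Eb fb; case: nb; exists b.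
  have [s3 [s3P s23 s3b]] := back _ s2P b Eb.
  exists s3; split=> //; split; first exact: approx_le_trans s23.
    by move=> a Da fa; apply: s23.1; apply: s2D.
  by move=> c _; rewrite -fb => /finj->.
have smono m n : (m <= n)%N -> approx_le (s m) (s n).
  move=> /subnKC <-; elim: (n - m) => [|k IHk]; first by rewrite addn0; apply: approx_le_refl.
  by rewrite addnS; apply: approx_le_trans IHk _; have [_ []] := sP (m + k)%N.
(* Stage [f x] puts a point [x] of [D] into the domain, and its value is frozen from then on;
   outside [D] the value is arbitrary. *)
pose G x := (s (f x).+1).1 x.
have sD x : D x -> (s (f x).+1).2 x.
  by move=> Dx; have [_ [_ + _]] := sP (f x); apply.
have GE n x : (s n).2 x -> G x = (s n).1 x.
  move=> snx.
  have Dx : D x by have [[_ _ + _] _] := sP n; apply.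
  have [_ <-//] := smono _ _ (leq_maxl n (f x).+1).
  by have [_ ->//] := smono _ _ (leq_maxr n (f x).+1); apply: sD.
exists G; split.
- by rewrite -s00 => x; apply: GE.
- move=> _ [x Dx <-]; have [[_ _ _ +] _] := sP (f x).+1; apply.
  by exists x => //; apply: sD.
- move=> b Eb; have [_ [_ _ /(_ b Eb erefl)[x sx <-]]] := sP (f b).
  exists x; last exact: GE.
  by have [[_ _ + _] _] := sP (f b).+1; apply.
move=> Y finY YD.
have [||n YX] := @finite_set_sub_chain _ (fun n => (s n).2) Y _ finY.
- by move=> n; apply: (smono _ _ (leqnSn n)).1.
- by move=> y /YD /sD sy; exists (f y).+1.
exists (s n).1; split=> [|y /YX /GE //].
by have [[]] := sP n.
Qed.

(** An endomorphism fixing the image of [X] pointwise and moving [g a] into [F] is composed after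
    [g]. *)
Lemma rich_core_forth {S : signature} {A : structure S} (D F : set A)
    (s : (A -> A) * set A) (a : A) :
  rich_core F -> finite_approx D F s -> D a ->
  exists s', [/\ finite_approx D F s', approx_le s s' & s'.2 a].
Proof.
case: s => g X [_ Fext] [/= ghom finX XD gXF] Da.
have [k [khom kfix kF]] := Fext _ (finite_image g finX) gXF (g a).
exists (k \o g, X `|` [set a]); split=> /=; last by right.
  split=> /=; first exact: homomorphism_comp.
  - by rewrite finite_setU.
  - by move=> x [/XD//|->].
  - move=> _ [x [Xx|->] <-] //=; rewrite kfix; last by exists x.
    by apply: gXF; exists x.
split=> /= x Xx; first by left.
by apply: kfix; exists x.
Qed.

(* Invert g on the rigid set X by h, move h b into F by an endomorphism k
   fixing X, and invert k \o h on the rigid set g @` X `|` [set b]. *)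
Lemma rich_core_back {S : signature} {A : structure S} (F : set A)
    (s : (A -> A) * set A) (b : A) :
  rich_core F -> finite_approx F F s -> F b ->
  exists s', [/\ finite_approx F F s', approx_le s s' & (s'.1 @` s'.2) b].
Proof.
case: s => g X [Frig Fext] [/= ghom finX XF gXF] Fb.
have [h [hhom hP]] := Frig X finX XF g ghom.
have [k [khom kfix kF]] := Fext X finX XF (h b).
have [|||g' [g'hom g'P]] := Frig (g @` X `|` [set b]) _ _ (k \o h).
- by rewrite finite_setU; split=> //; apply: finite_image.
- by move=> x [/gXF//|->].
- exact: homomorphism_comp.
have g'b : g' (k (h b)) = b by apply: g'P; right.
have g'g x : X x -> g' x = g x.
  move=> Xx; have /= := g'P (g x); rewrite hP // kfix //.
  by apply; left; exists x.
exists (g', X `|` [set k (h b)]); split=> /=.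
- split=> //=.
  + by rewrite finite_setU.
  + by move=> x [/XF//|->].
  + move=> _ [x [Xx|->] <-]; last by rewrite g'b.
    by rewrite g'g //; apply: gXF; exists x.
- by split=> // x Xx; left.
- by exists (k (h b)) => //; right.
Qed.

(** * Core, homogeneity, age and oligomorphy of F *)

(** Forth steps alone, from the empty approximation, reach all of [A]. The limit is a homomorphism
    because a tuple has finitely many points, on which it agrees with an endomorphism. *)
Lemma rich_core_retract {S : signature} {A : structure S} (F : set A) :
  countable [set: A] -> rich_core F ->
  exists e : A -> A, homomorphism e /\ range e `<=` F.
Proof.
move=> cA Frich.
have [|||e [_ eF _ eP]] :=
    @approx_limit S A setT set0 F (fun x => x, set0) cA.
- by split=> //= _ [x []].
- by move=> s sP a aT; apply: rich_core_forth.
- by [].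
exists e; split=> // R t tint.
have [//|g [ghom gP]] := eP _ (finite_set_range _ _ t).
rewrite (_ : e \o t = g \o t); first exact: ghom.
by apply/funext => i /=; apply: gP; exists i.
Qed.

(** On a finite tuple, the passage from [u] to [d \o f] extends to an endomorphism of [A]; rigidity
    undoes it, so [f] reflects equality and relations. [B] may be infinite, hence one tuple at a
    time. *)
Lemma rigid_homomorphism_embedding {S : signature} {A B D : structure S}
    (F : set A) (u : B -> A) (d : D -> A) (f : B -> D) :
  homomorphism_homogeneous A ->
  (forall X, finite_set X -> X `<=` F -> rigid X) ->
  embedding u -> range u `<=` F -> homomorphism d -> homomorphism f ->
  embedding f.
Proof.
move=> hhA Frig [uinj uint] uF dhom fhom.
have undo (J : finType) (s : J -> B) :
    exists k : A -> A, homomorphism k /\ forall j, k (d (f (s j))) = u (s j).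
  have [||||g [ghom gP]] :=
      @homomorphism_homogeneous_tuple S A J (u \o s) (d \o f \o s).
  - exact: hhA.
  - exact: finite_finset.
  - by move=> i j /= /uinj->.
  - by move=> R t; rewrite -[_ \o t]/(u \o (s \o t)) -uint => /fhom/dhom.
  have [|||h [hhom hP]] := Frig (range (u \o s)) _ _ g.
  - exact/finite_image/finite_finset.
  - by move=> _ [j _ <-]; apply: uF; exists (s j).
  - exact: ghom.
  exists h; split=> // j; have /= <- := gP j.
  by apply: hP; exists j.
split=> [x y fxy|R t].
  have [k [_ kP]] := undo bool (fun b => if b then x else y).
  by apply: uinj; rewrite -(kP true) -(kP false) fxy.
split; first exact: fhom.
have [k [khom kP]] := undo _ t.
move=> /dhom/khom; rewrite uint.
by rewrite (_ : k \o _ = u \o t)//; apply/funext => i; apply: kP.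
Qed.

Lemma rich_core_is_core {S : signature} {A : structure S} (F : set A) :
  homomorphism_homogeneous A -> rich_core F -> is_core (induced F).
Proof.
move=> hhA [Frig _] f fhom.
apply: (@rigid_homomorphism_embedding S A (induced F) (induced F) F val val f) => //.
by move=> _ [x _ <-]; apply/set_mem/valP.
Qed.

Lemma rich_core_automorphism {S : signature} {A : structure S} (F X : set A)
    (g : A -> A) :
  countable [set: A] -> homomorphism_homogeneous A -> rich_core F ->
  homomorphism g -> finite_set X -> X `<=` F -> g @` X `<=` F ->
  exists G : induced F -> induced F, isomorphism G /\
    forall x : induced F, X (val x) -> val (G x) = g (val x).
Proof.
move=> cA hhA Frich ghom finX XF gXF.
have [|||G [GX GF FG GP]] := @approx_limit S A F F F (g, X) cA.
- by [].
- by move=> s sP a Fa; apply: rich_core_forth.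
- by move=> s sP b Fb; apply: rich_core_back.
have FGx (x : induced F) : G (val x) \in F.
  by apply/mem_set/GF; exists (val x) => //; apply/set_mem/valP.
pose GI (x : induced F) : induced F := SigSub (FGx x).
exists GI; split=> [|x /GX //].
(* The core property gives injectivity and reflection of relations once [GI] is a homomorphism;
   surjectivity comes from the back steps. *)
have GIemb : embedding GI.
  apply: rich_core_is_core => // R t tint.
  have [|g' [g'hom g'P]] := GP _ (finite_set_range _ _ (val \o t)).
    by move=> _ [i _ <-]; apply/set_mem/valP.
  rewrite /= (_ : val \o (GI \o t) = g' \o (val \o t)); first exact: g'hom.
  by apply/funext => i /=; apply: g'P; exists i.
split=> //.
have /choice[H HP] : forall y : induced F, exists x : induced F, GI x = y.
  move=> y; have [x Fx xy] := FG _ (set_mem (valP y)).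
  by exists (SigSub (mem_set Fx)); apply: val_inj.
by exists H => // x; apply: GIemb.1.
Qed.

(** The finite isomorphism [f] is induced by an endomorphism of [A], which back-and-forth replaces
    by an automorphism of [F] with the same values on [X]. *)
Lemma rich_core_homogeneous {S : signature} {A : structure S} (F : set A) :
  countable [set: A] -> homomorphism_homogeneous A -> rich_core F ->
  homogeneous (induced F).
Proof.
move=> cA hhA Frich X Y finX finY f [[finj fint] _].
pose u (x : set_type X) : A := val (val x).
pose v (x : set_type X) : A := val (val (f x)).
have finXT : finite_set [set: set_type X].
  by rewrite (eq_finite_set (card_setT X)).
have [|||g [ghom gP]] := @homomorphism_homogeneous_tuple S A _ u v hhA.
- exact: finXT.
- by move=> i j /val_inj/val_inj->.
- by move=> R s /fint.
have [|||G [Giso GP]] :=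
    @rich_core_automorphism S A F (range u) g cA hhA Frich ghom.
- exact: finite_image.
- by move=> _ [x _ <-]; apply/set_mem/valP.
- by move=> _ [_ [x _ <-] <-]; rewrite gP; apply/set_mem/valP.
exists G; split=> // x; apply: val_inj.
by rewrite GP ?gP //; exists x.
Qed.

(** Rigidity puts the finite substructures of [F] in the class. Conversely, an endomorphism into [F]
    maps a copy of [B] onto a finite substructure of [A], and membership in the class makes this map
    an embedding. *)
Lemma rich_core_age {S : signature} {A B : structure S} (F : set A) :
  countable [set: A] -> homomorphism_homogeneous A -> rich_core F ->
  age (induced F) B <-> core_age A B.
Proof.
move=> cA hhA Frich; split=> [[finB [u uemb]]|[[finB [u uemb]] Bcore]].
  have vuemb : embedding (val \o u : B -> A).
    exact: embedding_comp uemb (embedding_val F).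
  split=> [|D [_ [d demb]] f fhom]; first by split=> //; exists (val \o u).
  apply: (@rigid_homomorphism_embedding S A B D F (val \o u) d f) => //.
  - exact: Frich.1.
  - by move=> _ [x _ <-]; apply/set_mem/valP.
  - exact: embedding_homomorphism.
split=> //.
have [e [ehom eF]] := rich_core_retract F cA Frich.
pose D := range (e \o u).
have eD x : e (u x) \in D by apply/mem_set; exists x.
have eFx x : e (u x) \in F by apply/mem_set/eF; exists (u x).
pose f (x : B) : induced D := SigSub (eD x).
have femb : embedding f.
  apply: Bcore; last exact: homomorphism_comp u e (embedding_homomorphism _ uemb) ehom.
  split; last by exists val; apply: embedding_val.
  have -> : [set: induced D] = range f; last exact: finite_image.
  apply/seteqP; split=> // y _; have [x _ xy] := set_mem (valP y).
  by exists x => //; apply: val_inj.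
have [vfinj vfint] := embedding_comp _ _ femb (embedding_val D).
exists (fun x => SigSub (eFx x)); split=> [x y /(congr1 val)|R t].
  exact: vfinj.
exact: vfint.
Qed.

Lemma rich_core_oligomorphic {S : signature} {A : structure S} (F : set A) :
  countable [set: A] -> weakly_oligomorphic A -> homomorphism_homogeneous A ->
  rich_core F -> oligomorphic (induced F).
Proof.
move=> cA woA hhA Frich n.
(* [orb U] is the union of the automorphism orbits of all tuples of [F] whose endomorphism orbit is
   [U]. Two such tuples are related by an endomorphism, hence by an automorphism of [F], so this
   union is at most one orbit. *)
pose orb (U : set ('I_n -> A)) : set ('I_n -> induced F) :=
  [set s | exists t : 'I_n -> induced F,
    endo_orbit (val \o t) = U /\ aut_orbit t s].
apply: sub_finite_set (finite_image orb (finite_endo_orbits n woA hhA)).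
move=> _ [t _ <-]; exists (endo_orbit (val \o t)); first by exists (val \o t).
apply/seteqP; split=> [s [t' [t't [h hiso <-]]]|s ts]; last by exists t.
have [g ghom /funeqP gP] : endo_orbit (val \o t) (val \o t').
  by rewrite -t't; apply: endo_orbit_refl.
have [|||G [Giso GP]] :=
    @rich_core_automorphism S A F (range (val \o t)) g cA hhA Frich ghom.
- exact: finite_set_range.
- by move=> _ [i _ <-]; apply/set_mem/valP.
- by move=> _ [_ [i _ <-] <-]; have /= -> := gP i; apply/set_mem/valP.
exists (h \o G).
  split; first exact: embedding_comp Giso.1 hiso.1.
  exact: bij_comp hiso.2 Giso.2.
apply/funext => i /=; congr h; apply: val_inj.
by rewrite GP; [apply: gP|exists i].
Qed.

Theorem mainTheorem13 (S : signature) (A : structure S) :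
  countable [set: A] -> weakly_oligomorphic A -> homomorphism_homogeneous A ->
  exists F : set A,
    [/\ core_of F,
        is_fraisse_limit (core_age A) (induced F)
      & oligomorphic (induced F)].
Proof.
move=> cA woA hhA.
have [F Frich] := exists_rich_core cA woA hhA.
exists F; split.
- by split; [apply: rich_core_is_core|apply: rich_core_retract].
- split; last by move=> B; apply: rich_core_age.
  + have /countable_injP[f finj] := cA.
    apply/countable_injP; exists (f \o val) => x y _ _ /= fxy.
    by apply/val_inj/finj; rewrite ?inE.
  + exact: rich_core_homogeneous.
- exact: rich_core_oligomorphic.
Qed.
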